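(* For each $k\in\{1,2,4,5\}$ (i.e. lengths $3k\in\{3,6,12,15\}$), there is, up to equivalence, exactly one binary linear $3$-CIS $[3k,k]$ code whose minimum distance is the largest possible among all $3$-CIS $[3k,k]$ codes. For $k=3$, the largest possible minimum distance of a $3$-CIS $[9,3]$ code is $4$, and there are exactly eight pairwise inequivalent $3$-CIS $[9,3,4]$ codes.
   Context: A binary linear $[tk,k]$ code is $t$-CIS if its coordinate set can be partitioned into $t$ pairwise disjoint information sets, where an information set of a linear $[n,k]$ code is a set of $k$ coordinates such that the corresponding $k$ columns of a generator matrix are linearly independent. Two codes are equivalent if one is obtained from the other by a permutation of coordinates. *)

(* Defs.v *)
From HB Require Import structures.
From mathcomp Require Import all_boot all_order all_algebra all_fingroup.
Set Implicit Arguments. Unset Strict Implicit. Unset Printing Implicit Defensive.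
Import GRing.Theory.
Local Open Scope ring_scope.

(* A binary linear [n,k] code is represented by a generator matrix
   G : 'M['F_2]_(k,n) of full row rank k; the code itself is the row space of G. *)
Definition gen_mx (k n : nat) (G : 'M['F_2]_(k, n)) : bool := row_free G.

Definition codeword (k n : nat) (G : 'M['F_2]_(k, n)) (v : 'rV['F_2]_n) : bool :=
  (v <= G)%MS.

Definition wt (n : nat) (v : 'rV['F_2]_n) : nat := #|[set j | v 0 j != 0]|.

(* minimum distance: least weight of a nonzero codeword (n if there is none) *)
Definition min_dist (k n : nat) (G : 'M['F_2]_(k, n)) : nat :=
  \big[minn/n]_(v : 'rV['F_2]_n | codeword G v && (v != 0)) wt v.

Definition cols_in (k n : nat) (G : 'M['F_2]_(k, n)) (S : {set 'I_n}) : 'M['F_2]_(k, n) :=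
  G *m diag_mx (\row_j (if j \in S then 1 else 0)).

Definition info_set (k n : nat) (G : 'M['F_2]_(k, n)) (S : {set 'I_n}) : bool :=
  (#|S| == k) && (\rank (cols_in G S) == k).

(* t-CIS: the coordinate set splits into t pairwise disjoint information sets
   (the partition is given by a block-assignment map f : 'I_n -> 'I_t) *)
Definition CIS (t k n : nat) (G : 'M['F_2]_(k, n)) : Prop :=
  exists f : {ffun 'I_n -> 'I_t},
    forall i : 'I_t, info_set G [set j | f j == i].

Definition code_equiv (k n : nat) (G1 G2 : 'M['F_2]_(k, n)) : Prop :=
  exists s : 'S_n, (col_perm s G1 == G2)%MS.

Definition cis3 (k : nat) (G : 'M['F_2]_(k, 3 * k)) : Prop :=
  gen_mx G /\ CIS 3 G.

(* Main.v *)
(* Row operations turn the generator matrix of a [3k,k] code into one whose columns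
   are, in some order, the k unit vectors and a multiset L of 2k further columns.
   Up to equivalence only the multiset L matters, and it is found by adding the
   rows one after the other: a row splits each class of equal column prefixes in
   two, and every nonzero combination of the rows so far must have weight at least
   d. For d one above the claimed optimum nothing survives; for the optimum the few
   surviving L without a zero column (t-CIS codes have none) are matched with the
   listed codes by searching for a linear map that permutes the columns. *)
Require Import Defs.
From mathcomp Require Import all_boot all_order all_algebra all_fingroup.
Set Implicit Arguments. Unset Strict Implicit. Unset Printing Implicit Defensive.
Import GRing.Theory.

(** * Bit sequences as vectors, and lazily evaluated quantifiers *)

Definition b2F (b : bool) : 'F_2 := (b : nat)%:R%R.

Fixpoint dotb (x c : bitseq) : bool :=
  match x, c with
  | a :: x', b :: c' => (a && b) (+) dotb x' c'
  | _, _ => false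
  end.

Fixpoint words (k : nat) : seq bitseq :=
  if k is k'.+1 then
    let w := words k' in map (cons true) w ++ map (cons false) w
  else [:: [::]].

Lemma mem_words k x : (x \in words k) = (size x == k).
Proof.
elim: k x => [|k IH] [|b x] //=.
  by rewrite mem_cat; apply/negbTE/negP=> /orP[] /mapP[].
rewrite mem_cat eqSS -IH; case: b.
  rewrite mem_map; last by move=> ? ? [].
  by case: (x \in _) => //=; apply/mapP=> -[].
rewrite orbC mem_map; last by move=> ? ? [].
by case: (x \in _) => //=; apply/mapP=> -[].
Qed.

(* Under [vm_compute] the boolean [||] and [&&] evaluate both of their arguments,
   so [has] and [all] do not stop early, whereas [find] does. *)
Definition lazy_has (T : Type) (a : pred T) (s : seq T) : bool :=
  find a s < size s.

Definition lazy_all (T : Type) (a : pred T) (s : seq T) : bool :=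
  ~~ lazy_has (predC a) s.

Lemma lazy_hasE (T : Type) (a : pred T) s : lazy_has a s = has a s.
Proof. by rewrite /lazy_has has_find. Qed.

Lemma lazy_allE (T : Type) (a : pred T) s : lazy_all a s = all a s.
Proof. by rewrite /lazy_all lazy_hasE has_predC negbK. Qed.

(** * Row-by-row enumeration of column multisets *)

Definition heavy d (L : seq bitseq) (x : bitseq) : bool :=
  has id x ==> (d <= count (dotb x) L).

Definition units k : seq bitseq :=
  [seq mkseq (fun i => i == j) k | j <- iota 0 k].

(** A pair [(p, n)] stands for [n] columns equal to [p]. The new entry goes in front, and [a] of the
    [n] columns receive a 1. *)
Definition split_head (p : bitseq) n (r : seq (seq (bitseq * nat))) :=
  flatten [seq [seq (true :: p, a) :: (false :: p, n - a) :: t | t <- r]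
          | a <- iota 0 n.+1].

Fixpoint splits (s : seq (bitseq * nat)) : seq (seq (bitseq * nat)) :=
  if s is (p, n) :: s' then split_head p n (splits s') else [:: [::]].

(* [heavy] for [units k ++ L]: the unit columns contribute [count id x]. *)
Definition sys_heavy d (L : seq bitseq) (x : bitseq) : bool :=
  has id x ==> (d <= count id x + count (dotb x) L).

Fixpoint tails d m k : seq (seq (bitseq * nat)) :=
  if k is k'.+1 then
    [seq s <- flatten (map splits (tails d m k')) |
      lazy_all (sys_heavy d (tally_seq s)) (words k)]
  else [:: [:: ([::], m)]].

(** Lets columns be reordered until their tails follow the order of a given tally. *)
Lemma perm_map_lift (S T : eqType) (f : S -> T) (s : seq S) (r : seq T) :
  perm_eq (map f s) r -> exists2 s', perm_eq s s' & map f s' = r.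
Proof.
elim: r s => [|y r IH] s.
  by move/perm_nilP => e; exists [::] => //; case: s e.
move=> e; have /mapP[x xs yx] : y \in map f s by rewrite (perm_mem e) mem_head.
have es := perm_to_rem xs.
have e' : perm_eq (map f (rem x s)) r.
  by rewrite -(perm_cons y) {1}yx -map_cons -(permPl (perm_map f es)).
have [s' e1 e2] := IH _ e'.
exists (x :: s'); last by rewrite /= e2 yx.
by rewrite (perm_trans es) // perm_cons.
Qed.

(** The first [n] columns share the tail [p]; sorting them by their leading bit gives [a] copies of
    [true :: p] and [n - a] of [false :: p], and induction treats the rest. *)
Lemma splits_cover (s : seq (bitseq * nat)) (L : seq bitseq) :
  all (fun c => 0 < size c) L ->
  map behead L = tally_seq s ->
  exists2 t, t \in splits s & perm_eq L (tally_seq t).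
Proof.
elim: s L => [|[p n] s IH] L Lpos.
  by case: L Lpos => // _ _; exists [::]; rewrite ?mem_head.
rewrite /tally_seq /= => e.
have e1 : map behead (take n L) = nseq n p.
  by rewrite map_take e take_size_cat ?size_nseq.
have e2 : map behead (drop n L) = tally_seq s.
  by rewrite map_drop e drop_size_cat ?size_nseq.
have [|t ts pt] := IH (drop n L) _ e2.
  by apply/allP=> c /mem_drop; apply: (allP Lpos).
have : exists2 a, a <= n &
    perm_eq (take n L) (nseq a (true :: p) ++ nseq (n - a) (false :: p)).
  have : all (fun c => 0 < size c) (take n L).
    by apply/allP=> c /mem_take; apply: (allP Lpos).
  move: (take n L) e1 => M; elim: n M {e e2 pt} => [|n IHn] [|[|b c] M] //=.
    by exists 0.
  move=> [-> eM] MP; have [a an pa] := IHn M eM MP.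
  case: b.
    by exists a.+1; rewrite // subSS /= perm_cons.
  exists a; first exact: leqW.
  rewrite subSn // perm_sym (perm_catCA _ [:: false :: p] _) /=.
  by rewrite perm_cons perm_sym.
case=> a an pa.
exists ((true :: p, a) :: (false :: p, n - a) :: t).
  rewrite [splits _]/= /split_head; apply/flatten_mapP.
  exists a; first by rewrite mem_iota add0n ltnS.
  by apply/map_f.
rewrite /tally_seq /= catA -{1}(cat_take_drop n L).
exact: perm_cat.
Qed.

Lemma perm_sys_heavy d L L' x : perm_eq L L' -> sys_heavy d L x = sys_heavy d L' x.
Proof. by rewrite /sys_heavy => /seq.permP ->. Qed.

(** Deleting the first row keeps the weight bound, since a combination [x] of the other rows is
    [false :: x] on all rows. So pruning after each row loses nothing. *)
Lemma tails_cover d m k (L : seq bitseq) :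
  size L = m -> all (fun c => size c == k) L -> all (sys_heavy d L) (words k) ->
  exists2 t, t \in tails d m k & perm_eq L (tally_seq t).
Proof.
move=> sL; elim: k L sL => [|k IH] L sL Lk hL.
  exists [:: ([::], m)]; first exact: mem_head.
  rewrite /tally_seq /= cats0 -sL; suff <- : L = nseq (size L) [::] by [].
  by elim: L Lk {sL hL} => //= c L IHL /andP[/nilP -> /IHL <-].
have [||| t tt pt] := IH (map behead L).
- by rewrite size_map.
- rewrite all_map; apply: sub_all Lk => c /= /eqP sc.
  by rewrite size_behead sc.
- apply/allP=> x xk.
  have /(allP hL) : false :: x \in words k.+1 by move: xk; rewrite !mem_words.
  rewrite /sys_heavy /= count_map; congr (_ ==> (_ <= _ + _)).
  apply: eq_in_count => c /(allP Lk).
  by case: c.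
have [L' pL eL] := perm_map_lift pt.
have [||u us pu] := @splits_cover t L'.
- by apply/allP=> c; rewrite -(perm_mem pL) => /(allP Lk) /eqP ->.
- by [].
exists u; last exact: perm_trans pu.
rewrite mem_filter lazy_allE; apply/andP; split; last by apply/flatten_mapP; exists t.
apply/allP=> x /(allP hL).
by rewrite (perm_sys_heavy _ _ (perm_trans pL pu)).
Qed.

(** * Dictionary between matrices over F_2 and lists of columns *)

Lemma b2FK (a : 'F_2) : b2F (a != 0%R) = a.
Proof. by case: a => -[|[|m]] // lt_m; apply/val_inj. Qed.

Lemma b2F_neq0 b : (b2F b != 0%R) = b.
Proof. by case: b. Qed.

Lemma F2_addb (a b : 'F_2) : ((a + b)%R != 0%R) = (a != 0%R) (+) (b != 0%R).
Proof. by rewrite -(b2FK a) -(b2FK b); case: (a != _); case: (b != _). Qed.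

Lemma F2_mulb (a b : 'F_2) : ((a * b)%R != 0%R) = (a != 0%R) && (b != 0%R).
Proof. by rewrite mulf_eq0 negb_or. Qed.

Definition bits k (x : 'I_k -> 'F_2) : bitseq := [seq x i != 0%R | i <- enum 'I_k].

Lemma size_bits k (x : 'I_k -> 'F_2) : size (bits x) = k.
Proof. by rewrite size_map size_enum_ord. Qed.

Lemma nth_bits k (x : 'I_k -> 'F_2) (i : 'I_k) : nth false (bits x) i = (x i != 0%R).
Proof. by rewrite (nth_map i) ?nth_ord_enum // size_enum_ord. Qed.

Lemma bits_inj k (x y : 'I_k -> 'F_2) : bits x = bits y -> x =1 y.
Proof. by move=> e i; rewrite -[LHS]b2FK -[RHS]b2FK -!nth_bits e. Qed.

Lemma bitsP k (c : bitseq) (x : 'I_k -> 'F_2) :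
  size c = k -> (forall i : 'I_k, (x i != 0%R) = nth false c i) -> bits x = c.
Proof.
move=> sc ex; apply: (@eq_from_nth _ false) => [|i]; first by rewrite size_bits.
by rewrite size_bits => lt_ik; rewrite -[i]/(val (Ordinal lt_ik)) nth_bits ex.
Qed.

Lemma has_bits k (x : 'rV['F_2]_k) : has id (bits (x 0%R)) = (x != 0%R).
Proof.
rewrite has_map; apply/idP/idP => [/hasP[i _ /= xi]|].
  by apply: contraNneq xi => ->; rewrite mxE.
apply: contraNT => /hasPn x0; apply/eqP/rowP=> i.
by rewrite mxE; apply/eqP; have := x0 i; rewrite mem_enum negbK => /(_ isT).
Qed.

Lemma dotb_sum k (x c : bitseq) : size x = k -> size c = k ->
  dotb x c = \big[addb/false]_(i < k) (nth false x i && nth false c i).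
Proof.
elim: k x c => [|k IH] [|a x] [|b c] //=; first by rewrite big_ord0.
by move=> [sx] [sc]; rewrite big_ord_recl /= (IH x c).
Qed.

Lemma dot_bits k (x y : 'I_k -> 'F_2) :
  dotb (bits x) (bits y) = ((\sum_i x i * y i)%R != 0%R).
Proof.
rewrite (dotb_sum (size_bits x) (size_bits y)).
have phi0 : ((0%R : 'F_2) != 0%R) = false by [].
rewrite (big_morph _ F2_addb phi0).
by apply: eq_bigr => i _; rewrite F2_mulb !nth_bits.
Qed.

Definition cols k n (U : 'M['F_2]_(k, n)) : seq bitseq :=
  [seq bits (fun i => U i j) | j <- enum 'I_n].

Lemma size_cols k n (U : 'M['F_2]_(k, n)) : size (cols U) = n.
Proof. by rewrite size_map size_enum_ord. Qed.

Lemma all_size_cols k n (U : 'M['F_2]_(k, n)) : all (fun c => size c == k) (cols U).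
Proof. by apply/allP=> _ /mapP[j _ ->]; rewrite size_bits. Qed.

Lemma nth_cols k n (U : 'M['F_2]_(k, n)) (j : 'I_n) :
  nth [::] (cols U) j = bits (fun i => U i j).
Proof. by rewrite (nth_map j) ?nth_ord_enum // size_enum_ord. Qed.

(** Entry [j] of the product is the dot product of [x] with column [j]; hence weights depend only on
    the multiset of columns. *)
Lemma wt_mul k n (x : 'rV['F_2]_k) (U : 'M['F_2]_(k, n)) :
  wt (x *m U)%R = count (dotb (bits (x 0%R))) (cols U).
Proof.
rewrite /wt cardsE cardE size_filter count_map -enumT; apply: eq_count => j /=.
rewrite dot_bits. by rewrite unfold_in mxE.
Qed.

Definition mx_of k n (L : seq bitseq) : 'M['F_2]_(k, n) :=
  (\matrix_(i, j) b2F (nth false (nth [::] L j) i))%R.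

Lemma cols_mx_of k n L : size L = n -> all (fun c => size c == k) L ->
  cols (mx_of k n L) = L.
Proof.
move=> sL Lk; apply: (@eq_from_nth _ [::]) => [|j]; rewrite size_cols // => ltj.
rewrite -[j]/(val (Ordinal ltj)) nth_cols; apply: bitsP => [|i].
  by apply/eqP/(allP Lk)/mem_nth; rewrite sL.
by rewrite mxE b2F_neq0.
Qed.

Definition mulcol k (T : seq bitseq) (c : bitseq) : bitseq :=
  mkseq (fun i => dotb [seq nth false t i | t <- T] c) k.

Lemma cols_mul k n (T : 'M['F_2]_k) (U : 'M['F_2]_(k, n)) :
  cols (T *m U)%R = map (mulcol k (cols T)) (cols U).
Proof.
rewrite -map_comp; apply: eq_map => j /=; apply: bitsP => [|i].
  by rewrite size_mkseq.
rewrite nth_mkseq // mxE -dot_bits; congr dotb.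
by rewrite -map_comp; apply: eq_map => l /=; rewrite nth_bits.
Qed.

Lemma perm_cols k n (U V : 'M['F_2]_(k, n)) :
  reflect (exists s, V = col_perm s U) (perm_eq (cols V) (cols U)).
Proof.
pose t := [tuple bits (fun i => U i j) | j < n].
apply: (iffP (@tuple_permP _ _ (cols V) t)) => -[s e]; exists s.
  apply/matrixP=> i j; rewrite mxE; move: i; apply: bits_inj.
  by rewrite -nth_cols e -(tnth_nth _ _ j) !tnth_mktuple.
rewrite e; apply: eq_map => j /=; rewrite tnth_mktuple.
by apply: bitsP => [|i]; rewrite ?size_bits // nth_bits mxE.
Qed.

(** * Minimum distance, systematic form and equivalence *)

Lemma min_dist_le k n (G : 'M['F_2]_(k, n)) v :
  codeword G v -> v != 0%R -> min_dist G <= wt v.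
Proof.
move=> Gv v0; rewrite /min_dist; have := mem_index_enum v.
elim: (index_enum _) => //= w r IH; rewrite inE big_cons.
case: eqP => [<- _|_ /= /IH le]; first by rewrite Gv v0 geq_minl.
by case: ifP => // _; apply: leq_trans le; apply: geq_minr.
Qed.

Lemma row_free_neq0 k n (G : 'M['F_2]_(k, n)) (x : 'rV_k) :
  row_free G -> x != 0%R -> (x *m G)%R != 0%R.
Proof.
by move=> fG; apply: contra_neq => e; apply: (row_free_inj fG); rewrite mul0mx.
Qed.

Lemma min_dist_heavy k n d (G : 'M['F_2]_(k, n)) :
  row_free G -> d <= min_dist G -> all (heavy d (cols G)) (words k).
Proof.
move=> fG dG; apply/allP=> c; rewrite mem_words => /eqP sc; apply/implyP=> c0.
pose x : 'rV['F_2]_k := (\row_i b2F (nth false c i))%R.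
have ex : bits (x 0%R) = c by apply: bitsP => // i; rewrite mxE b2F_neq0.
rewrite -ex -wt_mul; apply: leq_trans dG _; apply: min_dist_le.
  exact: submxMl.
by apply: row_free_neq0 fG _; rewrite -has_bits ex.
Qed.

Lemma bits_delta k (i : 'I_k) :
  bits (fun j => (1%:M : 'M['F_2]_k)%R j i) = mkseq (fun j => j == i) k.
Proof.
apply: bitsP => [|j]; rewrite ?size_mkseq //.
by rewrite nth_mkseq // mxE [RHS]val_eqE; case: (j == i).
Qed.

Lemma count_dot_units k c : size c = k -> count (dotb c) (units k) = count id c.
Proof.
move=> sc; pose x : 'rV['F_2]_k := (\row_i b2F (nth false c i))%R.
have ex : bits (x 0%R) = c by apply: bitsP => // i; rewrite mxE b2F_neq0.
have -> : units k = cols (1%:M : 'M['F_2]_k)%R.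
  rewrite /units -val_enum_ord -map_comp; apply: eq_map => i /=.
  by rewrite bits_delta.
rewrite -{1}ex -wt_mul mulmx1 /wt -ex count_map cardsE cardE size_filter -enumT.
exact: eq_count.
Qed.

(** Full rank provides [k] independent columns; multiplying by the inverse of that submatrix turns
    them into unit vectors, and [L] collects the other columns. *)
Lemma systematic_cols k n (G : 'M['F_2]_(k, n)) : row_free G ->
  exists2 P : 'M['F_2]_k, P \in unitmx &
  exists L, perm_eq (cols (P *m G)%R) (units k ++ L).
Proof.
move=> fG; have fGT : row_full (G^T)%R by rewrite /row_full mxrank_tr.
pose f := fullrankfun fGT.
have uQ : colsub f G \in unitmx.
  by rewrite -unitmx_tr trmx_mxsub; exact: fullrowsub_unit.
exists (invmx (colsub f G)); first by rewrite unitmx_inv.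
set U := (_ *m G)%R.
have fU : colsub f U = 1%:M%R.
  by rewrite /U -(mulVmx uQ) -mulmx_colsub.
exists [seq bits (fun i => U i j) | j <- enum 'I_n & j \notin codom f].
have -> : units k = [seq bits (fun i => U i j) | j <- codom f].
  rewrite /units -val_enum_ord /codom /image_mem -!map_comp.
  apply: eq_map => i /=; rewrite -bits_delta -fU.
  by apply: bitsP => [|j]; rewrite ?size_bits // nth_bits mxE.
rewrite -map_cat; apply: perm_map; rewrite perm_sym.
apply: (perm_trans (y := [seq j <- enum 'I_n | j \in codom f]
                         ++ [seq j <- enum 'I_n | j \notin codom f])).
  rewrite perm_cat2r; apply: uniq_perm.
  - by rewrite map_inj_uniq ?enum_uniq //; apply: fullrankfun_inj.
  - by rewrite filter_uniq ?enum_uniq.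
  by move=> j; rewrite mem_filter mem_enum andbT.
by rewrite perm_filterC.
Qed.

Lemma mul_row_free k n (P : 'M['F_2]_k) (G : 'M['F_2]_(k, n)) :
  P \in unitmx -> row_free G -> row_free (P *m G)%R.
Proof. by move=> uP; rewrite /row_free eqmxMfull // row_full_unit. Qed.

Lemma mul_min_dist k n (P : 'M['F_2]_k) (G : 'M['F_2]_(k, n)) :
  P \in unitmx -> min_dist (P *m G)%R = min_dist G.
Proof.
move=> uP; apply: eq_bigl => v; rewrite /codeword.
by rewrite (eqmxMfull G) // row_full_unit.
Qed.

(** The permutation matching the columns puts the row space of [G0] inside that of the permuted [G];
    as [G0] has rank [k], the two are equal. *)
Lemma equiv_of_cols k n (P : 'M['F_2]_k) (G G0 : 'M['F_2]_(k, n)) :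
  row_free G0 -> perm_eq (cols G0) (cols (P *m G)%R) -> code_equiv G G0.
Proof.
move=> fG0 /perm_cols[s e]; exists s.
have le : (G0 <= col_perm s G)%MS.
  by rewrite e !col_permE -mulmxA submxMl.
have [_ h] := mxrank_leqif_eq le.
have: (G0 == col_perm s G)%MS.
  by rewrite -h eqn_leq mxrankS // (eqP fG0) rank_leq_row.
by rewrite andbC.
Qed.

(** * Searching for a linear map between two column lists *)

(* [Q] prunes the search: every prefix that is extended has to satisfy it. *)
Fixpoint search_seq k (S : seq bitseq) (Q P : pred (seq bitseq)) T : bool :=
  if k is k'.+1 then
    lazy_has (fun c => let T' := rcons T c in
                       if Q T' then search_seq k' S Q P T' else false) S
  else P T.

Lemma search_seq_sound k S Q P T : search_seq k S Q P T ->
  exists T', [/\ size T' = k, all (mem S) T' & P (T ++ T')].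
Proof.
elim: k T => [|k IH] T /=; first by exists [::]; rewrite cats0.
rewrite lazy_hasE => /hasP[c cS]; case: ifP => // _ /IH[T' [sT TS PT]].
by exists (c :: T'); rewrite /= sT cS -cat_rcons.
Qed.

Lemma search_seq_complete k (S : seq bitseq) (P : pred (seq bitseq)) T T' :
  size T' = k -> all (mem S) T' -> P (T ++ T') -> search_seq k S predT P T.
Proof.
elim: k T T' => [|k IH] T [|c T'] //=; first by rewrite cats0.
move=> [sT] /andP[cS TS]; rewrite -cat_rcons lazy_hasE => PT.
by apply/hasP; exists c => //; apply: IH PT.
Qed.

(* A linear map is given by the list [T] of the images of the unit vectors; a
   prefix of [T] determines it on the columns supported on the first coordinates. *)
Definition prefix_compat k (L L0 T : seq bitseq) : bool :=
  lazy_all (fun c => (has id c == has id (mulcol k T c)) &&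
                     (count_mem (c ++ nseq (k - size T) false) L
                      == count_mem (mulcol k T c) L0)) (words (size T)).

(** Only members of [L0] are tried as images: when the unit vectors occur in [L], they must go to
    columns of [L0]. *)
Definition equivb k (L L0 : seq bitseq) : bool :=
  search_seq k L0 (prefix_compat k L L0)
    (fun T => perm_eq (map (mulcol k T) L) L0) [::].

Definition covered d m k (Ls : seq (seq bitseq)) : bool :=
  all (fun t => (nseq k false \in tally_seq t) ||
                lazy_has (equivb k (units k ++ tally_seq t)) Ls)
      (tails d m k).

Lemma tails_of_code k n d (G : 'M['F_2]_(k, n)) :
  row_free G -> d <= min_dist G ->
  exists2 P : 'M['F_2]_k, P \in unitmx &
  exists2 t, t \in tails d (n - k) k & perm_eq (cols (P *m G)%R) (units k ++ tally_seq t).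
Proof.
move=> fG dG; have [P uP [L pL]] := systematic_cols fG.
exists P => //.
have fU := mul_row_free uP fG.
have := @min_dist_heavy _ _ d _ fU; rewrite mul_min_dist // => /(_ dG) hU.
have [||| t tt pt] := @tails_cover d (n - k) k L.
- rewrite -[n in RHS](size_cols (P *m G)%R) (perm_size pL).
  by rewrite size_cat size_map size_iota addKn.
- have := all_size_cols (P *m G)%R; rewrite (perm_all _ pL) all_cat.
  by case/andP.
- apply/allP=> c ck; have := allP hU c ck; rewrite /heavy /sys_heavy.
  rewrite (seq.permP pL) count_cat count_dot_units //.
  by apply/eqP; rewrite -mem_words.
by exists t; rewrite // (perm_trans pL) // perm_cat2l.
Qed.

Lemma min_dist_bound k n d (G : 'M['F_2]_(k, n)) :
  tails d.+1 (n - k) k = [::] -> row_free G -> min_dist G <= d.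
Proof.
move=> e fG; rewrite leqNgt; apply/negP=> dG.
by have [P _ [t]] := tails_of_code fG dG; rewrite e.
Qed.

(** * The CIS property: zero columns and certificates *)

Lemma rank_diag_set n (S : {set 'I_n}) :
  \rank (diag_mx (\row_j (if j \in S then 1 else 0)) : 'M['F_2]_n)%R <= #|S|.
Proof.
rewrite diag_mx_sum_delta -sum1_card [leqRHS]big_mkcond /=.
elim/big_ind2: _ => [|A a B b leA leB|i _]; first by rewrite mxrank0.
  exact: leq_trans (mxrank_add _ _) (leq_add _ _).
by rewrite mxE; case: ifP => _; rewrite ?scale0r ?mxrank0 ?scale1r ?mxrank_delta.
Qed.

(** The block of [j] is an information set; if column [j] were zero, the [k - 1] other columns of
    the block would already have rank [k]. *)
Lemma cis_col_neq0 t k n (G : 'M['F_2]_(k, n)) j :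
  CIS t G -> col j G != 0%R.
Proof.
case=> f fP; have /andP[/eqP cS /eqP rS] := fP (f j).
set S := [set i | f i == f j] in cS rS.
apply: contra_eq_neq rS => Gj0; rewrite neq_ltn; apply/orP; left.
have jS : j \in S by rewrite inE.
have -> : cols_in G S = cols_in G (S :\ j).
  apply/matrixP=> a b; rewrite /cols_in !mul_mx_diag !mxE in_setD1.
  case: (eqVneq b j) => [->|_] //=.
  by move/colP/(_ a): Gj0; rewrite !mxE => ->; rewrite !mul0r.
have lt_k : #|S :\ j| < k by rewrite -cS (cardsD1 j S) jS.
apply: leq_ltn_trans lt_k.
exact: leq_trans (mxrankM_maxr _ _) (rank_diag_set _).
Qed.

(** A decidable certificate: the weight bound [d] holds and is attained, and on each of the three
    consecutive blocks of [k] columns no nonzero combination of rows vanishes, so each is an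
    information set. *)
Definition good_code d k (L : seq bitseq) : bool :=
  [&& 0 < d <= 3 * k, size L == 3 * k, all (fun c => size c == k) L,
      all (heavy d L) (words k),
      has (fun x => has id x && (count (dotb x) L == d)) (words k) &
      all (fun b => all (fun x => has id x ==> has (dotb x) (take k (drop (b * k) L)))
                        (words k)) (iota 0 3)].

Lemma heavy_cols k n d (G : 'M['F_2]_(k, n)) (x : 'rV_k) :
  all (heavy d (cols G)) (words k) -> x != 0%R -> d <= wt (x *m G)%R.
Proof.
move=> hG x0; rewrite wt_mul.
have xk : bits (x 0%R) \in words k by rewrite mem_words size_bits.
by have /implyP := allP hG _ xk; apply; rewrite has_bits.
Qed.

Lemma heavy_row_free k n d (G : 'M['F_2]_(k, n)) :
  0 < d -> all (heavy d (cols G)) (words k) -> row_free G.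
Proof.
move=> d0 hG; apply: inj_row_free => x xG; apply/eqP/contraT => x0.
have := heavy_cols hG x0; rewrite xG leqNgt (leq_trans _ d0) // ltnS leqn0.
by rewrite cards_eq0; apply/eqP/setP=> j; rewrite !inE mxE eqxx.
Qed.

(** The bound [d <= n] covers the value [n] from which the minimum starts. *)
Lemma heavy_min_dist k n d (G : 'M['F_2]_(k, n)) :
  d <= n -> all (heavy d (cols G)) (words k) -> d <= min_dist G.
Proof.
move=> dn hG; rewrite /min_dist; elim/big_ind: _ => // [a b|v /andP[]].
  by rewrite leq_min => -> ->.
case/submxP=> x -> xG0; apply: heavy_cols hG _.
by apply: contra_neq xG0 => ->; rewrite mul0mx.
Qed.

Lemma good_code_min_dist d k L : good_code d k L ->
  min_dist (mx_of k (3 * k) L) = d.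
Proof.
case/and5P=> /andP[d0 dn] /eqP sL Lk hL /andP[/hasP[c ck /andP[c0 /eqP cd]] _].
have eL := cols_mx_of sL Lk; rewrite -eL in hL cd.
apply/eqP; rewrite eqn_leq heavy_min_dist // andbT -cd.
move: ck; rewrite mem_words => /eqP sc.
pose x : 'rV['F_2]_k := (\row_i b2F (nth false c i))%R.
have ex : bits (x 0%R) = c by apply: bitsP => // i; rewrite mxE b2F_neq0.
rewrite -ex -wt_mul; apply: min_dist_le; first exact: submxMl.
by apply: row_free_neq0 (heavy_row_free d0 hL) _; rewrite -has_bits ex.
Qed.

Lemma good_code_cis d k L : good_code d k L -> cis3 (mx_of k (3 * k) L).
Proof.
case/and5P=> /andP[d0 dn] /eqP sL Lk hL /andP[_ hB].
have eL := cols_mx_of sL Lk.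
split; first by apply: (heavy_row_free d0); rewrite eL.
have k0 : 0 < k by case: k dn {sL Lk hL hB eL} => //; rewrite leqNgt d0.
have blk (j : 'I_(3 * k)) : j %/ k < 3 by rewrite ltn_divLR.
exists [ffun j => Ordinal (blk j)] => b.
have lt_b (i : 'I_k) : b * k + i < 3 * k.
  apply: (leq_trans (n := b.+1 * k)); first by rewrite mulSnr ltn_add2l.
  by rewrite leq_mul2r ltn_ord orbT.
pose h i := Ordinal (lt_b i).
have inB i : h i \in [set j | [ffun j => Ordinal (blk j)] j == b].
  by rewrite inE ffunE -val_eqE /= divnMDl // divn_small ?addn0.
apply/andP; split.
  have -> : [set j | [ffun j => Ordinal (blk j)] j == b] = [set h i | i : 'I_k].
    apply/setP=> j; apply/idP/imsetP => [|[i _ ->]]; last exact: inB.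
    rewrite inE ffunE => /eqP/(congr1 val) /= jb.
    exists (Ordinal (ltn_pmod j k0)) => //; apply/val_inj => /=.
    by rewrite -jb -divn_eq.
  rewrite card_imset ?card_ord // => i i' /(congr1 val) /= /addnI e.
  exact/val_inj.
(* [cols_in] has [k] rows, so rank [k] means that only the zero combination vanishes on block
   [b]. *)
rewrite -[_ == k]/(row_free _); apply: inj_row_free => x xG.
apply/eqP/contraT; rewrite -has_bits => x0.
have bI : val b \in iota 0 3 by rewrite mem_iota ltn_ord.
have xk : bits (x 0%R) \in words k by rewrite mem_words size_bits.
have /implyP/(_ x0)/(has_nthP [::])[i] := allP (allP hB _ bI) _ xk.
have sB : size (take k (drop (b * k) L)) <= k by rewrite size_take_min geq_minl.
move=> /leq_trans/(_ sB) lt_ik; rewrite nth_take // nth_drop.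
rewrite -eL -[b * k + i]/(val (h (Ordinal lt_ik))) nth_cols dot_bits.
move: (Ordinal lt_ik) => j; have /rowP/(_ (h j)) := xG.
rewrite mulmxA mul_mx_diag !mxE inB mulr1 => ->.
by rewrite eqxx.
Qed.

(** * Classification from the computed lists *)

Lemma zero_col_cis t k n (G : 'M['F_2]_(k, n)) (P : 'M_k) :
  P \in unitmx -> CIS t G -> nseq k false \notin cols (P *m G)%R.
Proof.
move=> uP cG; apply/mapP=> -[j _ e].
have /eqP[] := cis_col_neq0 j cG.
rewrite -[col j G](mulKmx uP) colE (mulmxA P) -colE.
suff -> : col j (P *m G)%R = 0%R by rewrite mulmx0.
apply/colP=> i; rewrite !mxE.
have := nth_bits (fun i => (P *m G)%R i j) i.
rewrite -e nth_nseq if_same => /esym/negbFE/eqP.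
by rewrite mxE.
Qed.

Lemma covered_equiv d k Ls (G : 'M['F_2]_(k, 3 * k)) :
  all (good_code d k) Ls -> covered d (2 * k) k Ls ->
  cis3 G -> d <= min_dist G ->
  exists2 L, L \in Ls & code_equiv G (mx_of k (3 * k) L).
Proof.
move=> gLs cLs [fG cG] dG.
have [P uP [t]] := tails_of_code fG dG.
have -> : 3 * k - k = 2 * k by rewrite -{2}[k]mul1n -mulnBl.
move=> tt pt; have := allP cLs t tt; rewrite lazy_hasE => /orP[z|/hasP[L LLs]].
  by have := zero_col_cis uP cG; rewrite (perm_mem pt) mem_cat z orbT.
case/search_seq_sound=> T [sT TL pT]; exists L => //.
have gL := allP gLs _ LLs; have [fL _] := good_code_cis gL.
case/and5P: gL => _ /eqP sL Lk _ _.
(* [P] brings [G] to systematic form and [T] carries that form to the listed code. *)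
apply: (equiv_of_cols (P := mx_of k k T *m P)%R) => //.
have Tk : all (fun c => size c == k) T.
  by apply/allP=> c /(allP TL) /(allP Lk).
rewrite cols_mx_of // -mulmxA cols_mul cols_mx_of // perm_sym.
by rewrite (perm_trans _ pT) // perm_map.
Qed.

(** Emptiness at [d.+1] bounds the distance, the certificate shows that [d] is attained, and
    coverage by [L] alone gives uniqueness. *)
Lemma unique_optimal d k L :
  good_code d k L -> tails d.+1 (2 * k) k = [::] -> covered d (2 * k) k [:: L] ->
  exists d : nat,
       (forall G : 'M['F_2]_(k, 3 * k), cis3 G -> (min_dist G <= d)%N) /\
       (exists G0 : 'M['F_2]_(k, 3 * k),
          [/\ cis3 G0, min_dist G0 = d &
              forall G : 'M['F_2]_(k, 3 * k), cis3 G -> min_dist G = d ->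
                code_equiv G G0]).
Proof.
move=> gL e cL; exists d; split.
  move=> G [fG _]; apply: min_dist_bound fG.
  by rewrite -[X in _ - X]mul1n -mulnBl.
exists (mx_of k (3 * k) L); split; first exact: good_code_cis gL.
  exact: good_code_min_dist.
have gLs : all (good_code d k) [:: L] by rewrite /= gL.
move=> G cG dG; have [|L'] := covered_equiv gLs cL cG; first by rewrite dG.
by rewrite inE => /eqP ->.
Qed.

(** * Inequivalence and the eight codes of length 9 *)

(** An equivalence gives [D] with [G2 = D *m col_perm s G1], and the unpruned search runs over all
    square matrices by columns; if it fails, the codes are inequivalent. *)
Lemma equiv_mulcol k n (G1 G2 : 'M['F_2]_(k, n)) :
  code_equiv G1 G2 ->
  search_seq k (words k) predT
    (fun T => perm_eq (map (mulcol k T) (cols G1)) (cols G2)) [::].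
Proof.
case=> s /andP[_ /submxP[D eD]]; apply: (@search_seq_complete _ _ _ _ (cols D)).
- exact: size_cols.
- by apply/allP=> c /(allP (all_size_cols D)); rewrite -mem_words.
rewrite -cols_mul perm_sym; apply/perm_cols; exists s.
by rewrite eD !col_permE mulmxA.
Qed.

(* Columns are encoded as integers; bit [i] of the integer is the entry in row [i]. *)
Definition bin_cols k (s : seq nat) : seq bitseq :=
  [seq mkseq (fun i => odd (m %/ 2 ^ i)) k | m <- s].

(** The lists are ordered so that consecutive triples are bases of F_2^3, as [good_code]
    requires. *)
Definition codes3 : seq (seq bitseq) := map (bin_cols 3)
  [:: [:: 1; 2; 4; 1; 2; 6; 1; 4; 7]; [:: 1; 2; 4; 1; 3; 7; 2; 4; 7];
      [:: 1; 2; 4; 1; 2; 5; 3; 4; 6]; [:: 1; 2; 4; 1; 2; 4; 3; 5; 7];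
      [:: 1; 2; 4; 1; 2; 6; 1; 5; 7]; [:: 1; 2; 4; 1; 3; 6; 1; 5; 7];
      [:: 1; 2; 4; 1; 2; 7; 1; 4; 7]; [:: 1; 2; 4; 1; 2; 5; 3; 6; 7]].

Lemma codes3_good : all (good_code 4 3) codes3.
Proof. by vm_compute. Qed.

Lemma codes3_inequivalent : pairwise (fun L1 L2 =>
    ~~ search_seq 3 (words 3) predT
         (fun T => perm_eq (map (mulcol 3 T) L1) L2) [::]) codes3.
Proof. by vm_compute. Qed.

Lemma code_equiv_sym k n (G1 G2 : 'M['F_2]_(k, n)) :
  code_equiv G1 G2 -> code_equiv G2 G1.
Proof.
case=> s /andP[/submxP[D eD] /submxP[D' eD']]; exists s^-1%g.
have colK : col_perm s^-1 (col_perm s G1) = G1.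
  by rewrite !col_permE -mulmxA -perm_mxM invgK mulVg perm_mx1 mulmx1.
apply/andP; split.
  by rewrite eD' col_permE -mulmxA -col_permE colK submxMl.
by rewrite -{1}colK eD col_permE -mulmxA -col_permE submxMl.
Qed.

Theorem theorem5 :
  (forall k : nat, k \in [:: 1; 2; 4; 5]%N ->
     exists d : nat,
       (forall G : 'M['F_2]_(k, 3 * k), cis3 G -> (min_dist G <= d)%N) /\
       (exists G0 : 'M['F_2]_(k, 3 * k),
          [/\ cis3 G0, min_dist G0 = d &
              forall G : 'M['F_2]_(k, 3 * k), cis3 G -> min_dist G = d ->
                code_equiv G G0])) /\
  ((forall G : 'M['F_2]_(3, 3 * 3), cis3 G -> (min_dist G <= 4)%N) /\
   exists Gs : 'I_8 -> 'M['F_2]_(3, 3 * 3),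
     [/\ forall i, cis3 (Gs i) /\ min_dist (Gs i) = 4%N,
         forall i j, i != j -> ~ code_equiv (Gs i) (Gs j) &
         forall G : 'M['F_2]_(3, 3 * 3), cis3 G -> min_dist G = 4%N ->
           exists i, code_equiv G (Gs i)]).
Proof.
split=> [k|].
  rewrite !inE => /or4P[] /eqP ->.
  (* The repetition code of length 3. *)
  - by apply: (@unique_optimal 3 1 (bin_cols 1 [:: 1; 1; 1])); vm_compute.
  (* Every nonzero vector of F_2^2 occurs twice: a doubled simplex code. *)
  - by apply: (@unique_optimal 4 2 (bin_cols 2 [:: 1; 2; 1; 3; 2; 3])); vm_compute.
  (* The columns are the nonzero vectors of F_2^4 except 3, 12 and 15, which sum to zero: a
     punctured simplex code. *)
  - by apply: (@unique_optimal 6 4 (bin_cols 4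
      [:: 1; 2; 4; 8; 5; 6; 7; 9; 10; 11; 13; 14])); vm_compute.
  (* All vectors of weight 1 or 3 in F_2^5, that is, those of odd weight except 31: the punctured
     first-order Reed-Muller code. *)
  by apply: (@unique_optimal 7 5 (bin_cols 5
      [:: 1; 2; 4; 8; 16; 7; 11; 13; 19; 22; 14; 21; 25; 26; 28])); vm_compute.
split=> [G [fG _]|].
  by apply: min_dist_bound fG; vm_compute.
pose c3 i := nth [::] codes3 i.
have good (i : 'I_8) : good_code 4 3 (c3 i).
  by apply: (allP codes3_good); apply: mem_nth.
have cols_c3 (i : 'I_8) : cols (mx_of 3 (3 * 3) (c3 i)) = c3 i.
  by case/and5P: (good i) => _ /eqP sL Lk _ _; apply: cols_mx_of.
exists (fun i => mx_of 3 (3 * 3) (c3 i)); split=> [i|i j|G cG dG].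
- by split; [apply: good_code_cis (good i) | apply: good_code_min_dist].
(* [pairwise] speaks only of [i < j]; the other order follows by symmetry. *)
- move=> neq_ij; wlog lt_ij : i j neq_ij / i < j => [wl|] eq_ij.
    move: (neq_ij); rewrite -val_eqE neq_ltn => /orP[] lt; first exact: (wl i j).
    by apply: (wl j i) (code_equiv_sym eq_ij) => //; rewrite eq_sym.
  have /(pairwiseP [::]) /(_ i j (ltn_ord i) (ltn_ord j) lt_ij) := codes3_inequivalent.
  by have := equiv_mulcol eq_ij; rewrite !cols_c3 => ->.
have c3c : covered 4 (2 * 3) 3 codes3 by vm_compute.
have [|L /(nthP [::])[i lti <-] GL] := covered_equiv codes3_good c3c cG.
  by rewrite dG.
by exists (Ordinal lti).
Qed.
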